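(* Let $\mathbf{H}_2\in\mathbb{R}^{n\times n}$ be a symmetric positive definite matrix (a preconditioner for $\mathbf{A}_+$) such that all eigenvalues of $\mathbf{H}_2\mathbf{A}_+$ lie in the interval $[\lambda_{\min}(\mathbf{H}_2\mathbf{A}_+),\lambda_{\max}(\mathbf{H}_2\mathbf{A}_+)]$. Define $$\mathbf{H}_{3,\mathrm{inex}} := \mathbf{H}_2 + \mathbf{A}_+^{-1}\mathbf{V}_-\left(\boldsymbol{\Lambda}_-^{-1}-\mathbf{V}_-^\top\mathbf{A}_+^{-1}\mathbf{V}_-\right)^{-1}\mathbf{V}_-^\top\mathbf{A}_+^{-1}.$$ Then every eigenvalue $\lambda(\mathbf{H}_{3,\mathrm{inex}}\mathbf{A})$ of $\mathbf{H}_{3,\mathrm{inex}}\mathbf{A}$ satisfies $$\min(1,\lambda_{\min}(\mathbf{H}_2\mathbf{A}_+)) \le \lambda(\mathbf{H}_{3,\mathrm{inex}}\mathbf{A}) \le \max(1,\lambda_{\max}(\mathbf{H}_2\mathbf{A}_+)).$$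
   Context: Let $\mathbf{A}\in\mathbb{R}^{n\times n}$ be symmetric positive definite (spd). Let $\Omega^1,\dots,\Omega^N$ be subsets of $\{1,\dots,n\}$ with $\bigcup_{s=1}^N\Omega^s=\{1,\dots,n\}$, and $n^s=\#\Omega^s$. Let $\mathbf{R}^s\in\mathbb{R}^{n^s\times n}$ be the restriction matrix that is zero except that the block formed by the columns in $\Omega^s$ is the $n^s\times n^s$ identity. Let $\mathbf{B}^s\in\mathbb{R}^{n^s\times n^s}$ ($s=1,\dots,N$) be symmetric matrices (possibly indefinite) such that $\mathbf{A}=\sum_{s=1}^N{\mathbf{R}^s}^\top\mathbf{B}^s\mathbf{R}^s$. For each $s$, write $\mathbf{B}^s=\mathbf{V}^s\boldsymbol{\Lambda}^s{\mathbf{V}^s}^\top$ with $\mathbf{V}^s$ orthogonal and $\boldsymbol{\Lambda}^s$ diagonal with diagonal entries in non-decreasing order, and split $\mathbf{V}^s=[\mathbf{V}^s_-|\mathbf{V}^s_+]$, $\boldsymbol{\Lambda}^s=\mathrm{diag}(\boldsymbol{\Lambda}^s_-,\boldsymbol{\Lambda}^s_+)$, where $\boldsymbol{\Lambda}^s_-$ contains the non-positive eigenvalues and $\boldsymbol{\Lambda}^s_+$ the positive ones. Set $\mathbf{A}^s_+:=\mathbf{V}^s_+\boldsymbol{\Lambda}^s_+{\mathbf{V}^s_+}^\top$ and $\mathbf{A}^s_-:=-\mathbf{V}^s_-\boldsymbol{\Lambda}^s_-{\mathbf{V}^s_-}^\top$, so $\mathbf{B}^s=\mathbf{A}^s_+-\mathbf{A}^s_-$.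 Define $\mathbf{A}_+:=\sum_{s=1}^N{\mathbf{R}^s}^\top\mathbf{A}^s_+\mathbf{R}^s$ and $\mathbf{A}_-:=\sum_{s=1}^N{\mathbf{R}^s}^\top\mathbf{A}^s_-\mathbf{R}^s$. (Then $\mathbf{A}=\mathbf{A}_+-\mathbf{A}_-$, $\mathbf{A}_+$ is spd and $\mathbf{A}_-$ is symmetric positive semi-definite.) Let $n_-=\operatorname{rank}(\mathbf{A}_-)$ and let $\mathbf{A}_-=\mathbf{V}_-\boldsymbol{\Lambda}_-\mathbf{V}_-^\top$ be the diagonalization of $\mathbf{A}_-$ with its null part removed: $\boldsymbol{\Lambda}_-\in\mathbb{R}^{n_-\times n_-}$ is diagonal with the positive eigenvalues of $\mathbf{A}_-$, and $\mathbf{V}_-\in\mathbb{R}^{n\times n_-}$ has orthonormal columns. The matrix $\boldsymbol{\Lambda}_-^{-1}-\mathbf{V}_-^\top\mathbf{A}_+^{-1}\mathbf{V}_-$ is non-singular. *)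

(* Defs.v *)
From HB Require Import structures.
From mathcomp Require Import all_boot all_order all_algebra.
From mathcomp Require Import classical_sets reals complex.

Set Implicit Arguments.
Unset Strict Implicit.
Unset Printing Implicit Defensive.

Import Order.TTheory GRing.Theory Num.Theory.

Local Open Scope ring_scope.
Local Open Scope complex_scope.

Definition spd (R : realType) (n : nat) (M : 'M[R]_n) : Prop :=
  M^T = M /\ forall x : 'cV[R]_n, x != 0 -> 0 < (x^T *m M *m x) 0 0.

(* A real matrix need not be symmetric, so its eigenvalues are taken in the
   complex numbers. In the order of R[i], a%:C <= z <= b%:C entails that z is
   real.  *)
Definition spectrum (R : realType) (n : nat) (M : 'M[R]_n) : set R[i] :=
  [set z | eigenvalue (map_mx (real_complex R) M) z]%classic.

(* Only used for matrices whose spectrum is real; the sets below are finite, so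
   (when they are nonempty) inf and sup are a minimum and a maximum.  *)
Definition lambda_min (R : realType) (n : nat) (M : 'M[R]_n) : R :=
  inf [set l : R | spectrum M l%:C]%classic.

Definition lambda_max (R : realType) (n : nat) (M : 'M[R]_n) : R :=
  sup [set l : R | spectrum M l%:C]%classic.

(* enum_val lists the elements of a set of ordinals in increasing order, so the
   columns of restr W indexed by W form an identity block.  *)
Definition restr (R : realType) (n : nat) (W : {set 'I_n}) :
    'M[R]_(#|W|, n) :=
  \matrix_(i, j) (enum_val i == j)%:R.

Definition ordered_eigendecomposition (R : realType) (m : nat)
    (B V L : 'M[R]_m) : Prop :=
  [/\ V^T *m V = 1%:M,
      is_diag_mx L,
      forall i j : 'I_m, (i <= j)%N -> L i i <= L j j
    & B = V *m L *m V^T].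

Definition pos_idx (R : realType) (m : nat) (L : 'M[R]_m) : {set 'I_m} :=
  [set i | 0 < L i i].

Definition npos_idx (R : realType) (m : nat) (L : 'M[R]_m) : {set 'I_m} :=
  [set i | L i i <= 0].

(* V_W L_W V_W^T, where V_W is made of the columns of V indexed by W and L_W is
   the corresponding diagonal block of L. When the diagonal of L is
   nondecreasing, npos_idx L and pos_idx L are an initial and a final segment,
   and these blocks are those of V = [V_-|V_+] and L = diag(L_-, L_+).  *)
Definition spectral_part (R : realType) (m : nat) (V L : 'M[R]_m)
    (W : {set 'I_m}) : 'M[R]_m :=
  let f : 'I_#|W| -> 'I_m := enum_val in
  colsub f V *m mxsub f f L *m (colsub f V)^T.

Definition loc_plus (R : realType) (m : nat) (V L : 'M[R]_m) : 'M[R]_m :=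
  spectral_part V L (pos_idx L).

Definition loc_minus (R : realType) (m : nat) (V L : 'M[R]_m) : 'M[R]_m :=
  - spectral_part V L (npos_idx L).

Definition assemble (R : realType) (n N : nat) (Omega : 'I_N -> {set 'I_n})
    (M : forall s : 'I_N, 'M[R]_#|Omega s|) : 'M[R]_n :=
  \sum_(s < N) (restr R (Omega s))^T *m M s *m restr R (Omega s).

Definition Aplus (R : realType) (n N : nat) (Omega : 'I_N -> {set 'I_n})
    (V L : forall s : 'I_N, 'M[R]_#|Omega s|) : 'M[R]_n :=
  assemble (fun s => loc_plus (V s) (L s)).

Definition Aminus (R : realType) (n N : nat) (Omega : 'I_N -> {set 'I_n})
    (V L : forall s : 'I_N, 'M[R]_#|Omega s|) : 'M[R]_n :=
  assemble (fun s => loc_minus (V s) (L s)).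

(* Since L has size \rank M, its diagonal lists all the positive
   eigenvalues of M with multiplicity, and M has no negative one.  *)
Definition reduced_diagonalization (R : realType) (n : nat) (M : 'M[R]_n)
    (V : 'M[R]_(n, \rank M)) (L : 'M[R]_(\rank M)) : Prop :=
  [/\ V^T *m V = 1%:M,
      is_diag_mx L,
      forall i, 0 < L i i
    & M = V *m L *m V^T].

Definition H3inex (R : realType) (n r : nat) (H2 Ap : 'M[R]_n)
    (Vm : 'M[R]_(n, r)) (Lm : 'M[R]_r) : 'M[R]_n :=
  H2 + invmx Ap *m Vm
       *m invmx (invmx Lm - Vm^T *m invmx Ap *m Vm)
       *m Vm^T *m invmx Ap.

(* Main.v *)
Require Import Defs.
From HB Require Import structures.
From mathcomp Require Import all_boot all_order all_algebra.
From mathcomp Require Import classical_sets reals complex.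
From mathcomp Require Import ring.

Set Implicit Arguments.
Unset Strict Implicit.
Unset Printing Implicit Defensive.

Import Order.TTheory GRing.Theory Num.Theory.

Local Open Scope ring_scope.
Local Open Scope complex_scope.

(** Write [P] for [Aplus V L] and [M] for [Aminus V L], so that [A = P - M] with
    [M] positive semidefinite and [P] positive definite.  The correction term of
    [H3inex] is the one of the Woodbury formula for [(P - M)^-1] ([woodbury]), so
    [H3inex = H2 + A^-1 - P^-1].

    Let [v] be a (complex) left eigenvector of [H3inex *m A] for [z].  Multiplying
    [v H3inex A = z v] on the right by [A^-1 v^*] gives
      [(z - 1) q = h - p]
    where [h], [q], [p] are the values at [v] of the Hermitian forms of [H2],
    [A^-1] and [P^-1].  Two inequalities then finish the proof.
    - Since [A <= P] we have [0 < p <= q] ([invmx_antitone]).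
    - If the spectrum of [H2 P] lies in [[a, b]], then [a p <= h <= b p]
      ([pencil_bounds]): with [P = S^* S], the matrix [H2 P] is similar to the
      Hermitian matrix [S H2 S^*], to which the Rayleigh bounds apply.
    When [a <= 1 <= b] they yield
      [(a - 1) q <= (a - 1) p <= h - p <= (b - 1) p <= (b - 1) q],
    that is [a <= z <= b]; in particular [z] is real.  The theorem is the case
    [a = min(1, lambda_min)], [b = max(1, lambda_max)].

    The spectrum is a set of complex numbers, so the argument is carried out for
    Hermitian forms over a numeric closed field, and the real matrices of the
    theorem are mapped into the complex numbers ([spd_hpd]). *)

(** * Inverses of a matrix and of its perturbations *)

Lemma invmxM (F : comUnitRingType) n (X Y : 'M[F]_n) :
  X \in unitmx -> Y \in unitmx -> invmx (X *m Y) = invmx Y *m invmx X.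
Proof.
move=> Xu Yu; have XYu : X *m Y \in unitmx by rewrite unitmx_mul Xu.
by rewrite -[RHS](mulmxK XYu) mulmxA mulmxKV // mulVmx // mul1mx.
Qed.

Lemma invmxB (F : fieldType) n (A P : 'M[F]_n) :
    A \in unitmx -> P \in unitmx ->
  invmx A - invmx P = invmx P *m (P - A) *m invmx A.
Proof. by move=> Au Pu; rewrite mulmxBr mulmxBl mulVmx // mul1mx mulmxK. Qed.

(** The symmetric form of the resolvent identity: with [M = P - A] the difference
    of inverses is [P^-1 (M + M A^-1 M) P^-1], which is visibly positive when [M]
    and [A^-1] are.  It also is what the Woodbury correction expands to. *)
Lemma invmxB_sym (F : fieldType) n (A P : 'M[F]_n) :
    A \in unitmx -> P \in unitmx ->
  invmx A - invmx P
    = invmx P *m (P - A + (P - A) *m invmx A *m (P - A)) *m invmx P.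
Proof.
move=> Au Pu; rewrite {1}invmxB //.
have -> : P - A + (P - A) *m invmx A *m (P - A) = (P - A) *m invmx A *m P.
  by rewrite -{1}(mulmxKV Au (P - A)) -mulmxDr [A + _]addrC subrK.
by rewrite !mulmxA mulmxK.
Qed.

(** The capacitance matrix [L^-1 - W P^-1 U] is invertible as soon as [A] and [P]
    are, because [L + L W A^-1 U L] is its inverse; substituting this inverse in
    the correction gives the right-hand side of [invmxB_sym]. *)
Lemma woodbury (F : fieldType) n r (A P : 'M[F]_n) (U : 'M[F]_(n, r))
    (W : 'M[F]_(r, n)) (L : 'M[F]_r) :
    A \in unitmx -> P \in unitmx -> L \in unitmx -> P - A = U *m L *m W ->
  invmx P *m U *m invmx (invmx L - W *m invmx P *m U) *m W *m invmx P
    = invmx A - invmx P.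
Proof.
move=> Au Pu Lu PAE; pose T := L + L *m W *m invmx A *m U *m L.
have ST : (invmx L - W *m invmx P *m U) *m T = 1%:M.
  have -> : (invmx L - W *m invmx P *m U) *m T = 1%:M +
      W *m (invmx A - invmx P - invmx P *m (U *m L *m W) *m invmx A) *m U *m L.
    rewrite /T !(mulmxDr, mulmxDl, mulmxN, mulNmx) !mulmxA mulVmx // mul1mx.
    by rewrite !addrA [_ - _ + _]addrAC.
  by rewrite -PAE -invmxB // subrr mulmx0 !mul0mx addr0.
have [Su _] := mulmx1_unit ST.
have -> : invmx (invmx L - W *m invmx P *m U) = T.
  by rewrite -[RHS](mulKmx Su) ST mulmx1.
by rewrite invmxB_sym // PAE /T !(mulmxDr, mulmxDl) !mulmxA.
Qed.

(** * Hermitian forms and spectra *)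

Section HermitianForms.
Local Open Scope sesquilinear_scope.
Variable C : numClosedFieldType.

Definition hform n (M : 'M[C]_n) (v : 'rV[C]_n) : C := (v *m M *m v^t*) 0 0.

Definition psd n (M : 'M[C]_n) : Prop := forall v, 0 <= hform M v.

Definition hpd n (M : 'M[C]_n) : Prop :=
  M^t* = M /\ forall v, v != 0 -> 0 < hform M v.

Lemma hformD n (M K : 'M[C]_n) v : hform (M + K) v = hform M v + hform K v.
Proof. by rewrite /hform mulmxDr mulmxDl mxE. Qed.

Lemma hformN n (M : 'M[C]_n) v : hform (- M) v = - hform M v.
Proof. by rewrite /hform mulmxN mulNmx mxE. Qed.

Lemma ctmxM m n p (X : 'M[C]_(m, n)) (Y : 'M[C]_(n, p)) :
  (X *m Y)^t* = Y^t* *m X^t*.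
Proof. by rewrite trmx_mul map_mxM. Qed.

Lemma hform_congr m n (X : 'M[C]_(n, m)) (M : 'M[C]_m) v :
  hform (X *m M *m X^t*) v = hform M (v *m X).
Proof. by rewrite /hform ctmxM !mulmxA. Qed.

Lemma hform_diag n (d : 'rV[C]_n) v :
  hform (diag_mx d) v = \sum_i d 0 i * `|v 0 i| ^+ 2.
Proof.
rewrite /hform mul_mx_diag mxE; apply: eq_bigr => i _.
by rewrite !mxE normCK mulrAC mulrC.
Qed.

Lemma psd_diag n (d : 'rV[C]_n) : (forall i, 0 <= d 0 i) -> psd (diag_mx d).
Proof.
move=> d_ge0 v; rewrite hform_diag; apply: sumr_ge0 => i _.
by rewrite mulr_ge0 ?exprn_ge0.
Qed.

Lemma psdD n (M K : 'M[C]_n) : psd M -> psd K -> psd (M + K).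
Proof. by move=> Mp Kp v; rewrite hformD addr_ge0. Qed.

Lemma psd_congr m n (X : 'M[C]_(n, m)) (M : 'M[C]_m) :
  psd M -> psd (X *m M *m X^t*).
Proof. by move=> Mp v; rewrite hform_congr. Qed.

Lemma hpd_psd n (M : 'M[C]_n) : hpd M -> psd M.
Proof.
case=> _ Mp v; case: (eqVneq v 0) => [->|/Mp/ltW//].
by rewrite /hform !mul0mx mxE.
Qed.

Lemma hpdD n (M K : 'M[C]_n) : K^t* = K -> hpd M -> psd K -> hpd (M + K).
Proof.
move=> Kh [Mh Mp] Kp; split; first by rewrite linearD map_mxD /= Mh Kh.
by move=> v v0; rewrite hformD ltr_wpDr ?Mp.
Qed.

Lemma hpd_unitmx n (M : 'M[C]_n) : hpd M -> M \in unitmx.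
Proof.
case=> _ Mp; rewrite -row_free_unit; apply: inj_row_free => v vM.
by apply/eqP; apply: contraT => /Mp; rewrite /hform vM mul0mx mxE ltxx.
Qed.

Lemma ctmx_inv n (M : 'M[C]_n) : (invmx M)^t* = invmx (M^t*).
Proof. by rewrite trmx_inv map_invmx. Qed.

(** Positivity is preserved by congruence, and [M^-1 = M^-1 M (M^-1)^*]. *)
Lemma hpd_inv n (M : 'M[C]_n) : hpd M -> hpd (invmx M).
Proof.
move=> Mpd; have Mu := hpd_unitmx Mpd; case: Mpd => Mh Mp.
have invMh : (invmx M)^t* = invmx M by rewrite ctmx_inv Mh.
split=> // v v0; have -> : invmx M = invmx M *m M *m (invmx M)^t*.
  by rewrite invMh mulVmx // mul1mx.
rewrite hform_congr Mp //; apply: contra_neq v0 => vM.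
by rewrite -[v](mulmxKV Mu) vM mul0mx.
Qed.

Lemma hpd1 n : hpd (1%:M : 'M[C]_n).
Proof.
split; first by rewrite trmx1 map_mx1.
move=> v v0; rewrite -diag_const_mx hform_diag.
have /rV0Pn[i vi] := v0; rewrite (bigD1 i) //= mxE mul1r ltr_wpDr //.
  by apply: sumr_ge0 => j _; rewrite mxE mul1r exprn_ge0.
by rewrite exprn_gt0 // normr_gt0.
Qed.

(** The spectral theorem, together with the fact that the diagonal entries are
    eigenvalues: row [i] of [U] is an eigenvector for [d 0 i]. *)
Lemma hermitian_diagonalization n (M : 'M[C]_n) : M^t* = M ->
  exists (U : 'M[C]_n) (d : 'rV[C]_n),
    [/\ U \is unitarymx, M = U^t* *m diag_mx d *m U &
        forall i, eigenvalue M (d 0 i)].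
Proof.
move=> Mh; have /orthomx_spectralP : M \is normalmx by apply/normalmxP; rewrite Mh.
have := spectral_unitarymx M.
move: (spectralmx M) (spectral_diag M) => U d Uu.
rewrite invmx_unitary // => MU; exists U, d; split=> // i.
apply/eigenvalueP; exists (delta_mx 0 i *m U).
  rewrite MU -!mulmxA (mulmxA U) (unitarymxP Uu) mul1mx !mulmxA scalemxAl.
  congr (_ *m _); apply/rowP=> j; rewrite mul_mx_diag !mxE eqxx /=.
  by case: eqVneq => [->|_]; rewrite ?mul0r ?mulr0 // mulrC.
apply: contraTneq isT => /(congr1 (mulmx^~ (U^t*))).
rewrite -mulmxA (unitarymxP Uu) mulmx1 mul0mx => /rowP/(_ i).
by rewrite !mxE !eqxx => /eqP; rewrite oner_eq0.
Qed.

Lemma rayleigh_bounds n (M : 'M[C]_n) (a b : C) : M^t* = M ->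
    (forall z, eigenvalue M z -> a <= z <= b) ->
  forall v, a * hform 1%:M v <= hform M v <= b * hform 1%:M v.
Proof.
move=> Mh Mab v; have [U [d [Uu MU dM]]] := hermitian_diagonalization Mh.
have -> : hform M v = hform (diag_mx d) (v *m U^t*).
  by rewrite -hform_congr trmxCK -MU.
have -> : hform 1%:M v = hform (diag_mx (const_mx 1)) (v *m U^t*).
  rewrite -hform_congr trmxCK diag_const_mx mulmx1.
  by rewrite -invmx_unitary ?mulVmx ?unitarymx_unit.
rewrite !hform_diag !mulr_sumr; apply/andP; split; apply: ler_sum => i _;
  rewrite [const_mx _ _ _]mxE mul1r ler_wpM2r ?exprn_ge0 //;
  by case/andP: (Mab _ (dM i)).
Qed.

Lemma hpd_eigenvalue_gt0 n (M : 'M[C]_n) z : hpd M -> eigenvalue M z -> 0 < z.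
Proof.
case=> _ Mp /eigenvalueP[v vM v0]; have [_ /(_ v v0) v1] := hpd1 n.
rewrite -(pmulr_lgt0 _ v1); have := Mp v v0.
by rewrite /hform vM mulmx1 -scalemxAl mxE.
Qed.

(** [S] is the matrix [sqrt(D) U] read off the diagonalization [M = U^* D U]. *)
Lemma hpd_factor n (M : 'M[C]_n) : hpd M ->
  exists2 S : 'M[C]_n, S \in unitmx & M = S^t* *m S.
Proof.
move=> Mpd; have [U [d [Uu MU dM]]] := hermitian_diagonalization Mpd.1.
have ME : M = (diag_mx (map_mx sqrtC d) *m U)^t* *m (diag_mx (map_mx sqrtC d) *m U).
  rewrite ctmxM mulmxA -[X in X *m U]mulmxA {1}MU; congr (_ *m _ *m _).
  rewrite tr_diag_mx map_diag_mx mulmx_diag; congr diag_mx.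
  apply/rowP => i; rewrite !mxE.
  have d_ge0 : 0 <= d 0 i by rewrite ltW ?(hpd_eigenvalue_gt0 Mpd).
  by rewrite /= conj_Creal ?ger0_real ?sqrtC_ge0 // -expr2 sqrtCK.
exists (diag_mx (map_mx sqrtC d) *m U) => //.
by have := hpd_unitmx Mpd; rewrite {1}ME unitmx_mul => /andP[].
Qed.

(** With [P = S^* S], a left eigenvector [w] of the Hermitian matrix [S H S^*]
    yields the eigenvector [w S] of [H P] for the same eigenvalue.  Hence the
    Rayleigh bounds for [S H S^*] at [v S^-1] hold with the bounds on the spectrum
    of [H P]; there, [S H S^*] takes the value of [H] at [v] and the identity that
    of [P^-1]. *)
Lemma pencil_bounds n (H P : 'M[C]_n) (a b : C) : H^t* = H -> hpd P ->
    (forall z, eigenvalue (H *m P) z -> a <= z <= b) ->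
  forall v, a * hform (invmx P) v <= hform H v <= b * hform (invmx P) v.
Proof.
move=> Hh /hpd_factor[S Su ->] HPab v.
have Stu : S^t* \in unitmx by rewrite map_unitmx unitmx_tr.
have -> : hform H v = hform (S *m H *m S^t*) (v *m invmx S).
  rewrite -hform_congr ctmx_inv -!mulmxA mulmxV // mulmx1.
  by rewrite mulKmx.
have -> : hform (invmx (S^t* *m S)) v = hform 1%:M (v *m invmx S).
  by rewrite -hform_congr mulmx1 ctmx_inv invmxM.
apply: rayleigh_bounds.
  by rewrite !ctmxM trmxCK Hh mulmxA.
move=> z /eigenvalueP[w wK w0]; apply: HPab; apply/eigenvalueP; exists (w *m S).
  by rewrite scalemxAl -wK !mulmxA.
by apply: contra_neq w0 => wS; rewrite -[w](mulmxK Su) wS mul0mx.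
Qed.

Lemma invmx_antitone n (A P : 'M[C]_n) : hpd A -> hpd P -> psd (P - A) ->
  psd (invmx A - invmx P).
Proof.
move=> Apd Ppd Mpsd; have Au := hpd_unitmx Apd; have Pu := hpd_unitmx Ppd.
have Mh : (P - A)^t* = P - A by rewrite linearB map_mxB /= Apd.1 Ppd.1.
have Pih : (invmx P)^t* = invmx P by rewrite ctmx_inv Ppd.1.
have -> : invmx A - invmx P = invmx P *m (P - A +
    (P - A) *m invmx A *m (P - A)^t*) *m (invmx P)^t*.
  by rewrite Pih Mh; apply: invmxB_sym.
apply: psd_congr; apply: psdD => //; apply: psd_congr.
exact/hpd_psd/hpd_inv.
Qed.

(** For a left eigenvector [v], the eigenvalue equation multiplied by [A^-1 v^*]
    reads [h + q - p = z q] with [h], [q], [p] the values at [v] of [H], [A^-1],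
    [P^-1].  Then [(z - a) q = (h - a p) + (1 - a) (q - p)] and
    [(b - z) q = (b p - h) + (b - 1) (q - p)], where every factor on the right is
    nonnegative. *)
Lemma corrected_preconditioner_spectrum n (A P H : 'M[C]_n) (a b : C) :
    hpd A -> hpd P -> psd (P - A) -> H^t* = H -> a <= 1 -> 1 <= b ->
    (forall z, eigenvalue (H *m P) z -> a <= z <= b) ->
  forall z, eigenvalue ((H + invmx A - invmx P) *m A) z -> a <= z <= b.
Proof.
move=> Apd Ppd Mpsd Hh a1 b1 HPab z /eigenvalueP[v vz v0].
have Au := hpd_unitmx Apd.
have /andP[lo hi] := pencil_bounds Hh Ppd HPab v.
have := invmx_antitone Apd Ppd Mpsd v; rewrite hformD hformN subr_ge0 => pq.
have := (hpd_inv Ppd).2 v v0; have := (hpd_inv Apd).2 v v0.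
have : hform H v + hform (invmx A) v - hform (invmx P) v = z * hform (invmx A) v.
  rewrite -hformN -!hformD {1}/hform.
  by rewrite -[_ - _](mulmxK Au) mulmxA vz -!scalemxAl mxE.
move: (hform H v) (hform (invmx A) v) (hform (invmx P) v) lo hi pq.
move=> h q p lo hi pq E q0 p0.
rewrite -(ler_pM2r q0) -[z <= b](ler_pM2r q0) -E -addrA; apply/andP; split.
  rewrite -subr_ge0 (_ : _ - _ = (h - a * p) + (1 - a) * (q - p)); last by ring.
  by rewrite addr_ge0 ?mulr_ge0 ?subr_ge0.
rewrite -subr_ge0 (_ : _ - _ = (b * p - h) + (b - 1) * (q - p)); last by ring.
by rewrite addr_ge0 ?mulr_ge0 ?subr_ge0.
Qed.

End HermitianForms.

(** * Real matrices seen as complex ones *)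

Section RealMatrices.
Local Open Scope sesquilinear_scope.
Variable R : realType.

Local Notation toC := (map_mx (real_complex R)).

Lemma ctmx_real m n (M : 'M[R]_(m, n)) : (toC M)^t* = toC M^T.
Proof.
apply/matrixP => i j; rewrite !mxE; apply: conj_Creal.
by apply/complex_realP; exists (M j i).
Qed.

(** The cross terms [i (b M a^T - a M b^T)] vanish by symmetry of [M]. *)
Lemma hform_real n (M : 'M[R]_n) (a b : 'rV[R]_n) : M^T = M ->
  hform (toC M) (toC a + 'i%C *: toC b)
    = ((a *m M *m a^T) 0 0 + (b *m M *m b^T) 0 0)%:C.
Proof.
move=> Ms; have ab : a *m M *m b^T = b *m M *m a^T.
  have <- : (a *m M *m b^T)^T = b *m M *m a^T.
    by rewrite !trmx_mul trmxK Ms mulmxA.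
  by apply/matrixP => i j; rewrite [RHS]mxE !ord1.
have vs : (toC a + 'i%C *: toC b)^t* = toC a^T - 'i%C *: toC b^T.
  have cE (z : R[i]) : Num.conj z = conjc z by [].
  by apply/colP => k; rewrite !mxE cE; simpc.
rewrite /hform vs !(mulmxDr, mulmxDl, mulmxN) -!scalemxAl -!scalemxAr -!map_mxM ab.
rewrite scalerA -expr2 sqr_i !scaleN1r opprK addrA.
by rewrite addrK -map_mxD !mxE.
Qed.

Lemma spd_hpd n (M : 'M[R]_n) : spd M -> hpd (toC M).
Proof.
case=> Ms Mp; split; first by rewrite ctmx_real Ms.
move=> v v0.
pose a : 'rV[R]_n := map_mx (@complex.Re R) v.
pose b : 'rV[R]_n := map_mx (@complex.Im R) v.
have vE : v = toC a + 'i%C *: toC b.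
  by apply/rowP => i; rewrite !mxE -complexE.
have quad_gt0 (x : 'rV[R]_n) : x != 0 -> 0 < (x *m M *m x^T) 0 0.
  by move=> x0; rewrite -{1}[x]trmxK Mp // trmx_eq0.
have quad_ge0 (x : 'rV[R]_n) : 0 <= (x *m M *m x^T) 0 0.
  by case: (eqVneq x 0) => [->|/quad_gt0/ltW//]; rewrite !mul0mx mxE.
rewrite vE hform_real // ltcR; have [a0|a0] := eqVneq a 0; last first.
  by rewrite ltr_wpDr ?quad_gt0.
rewrite ltr_wpDl ?quad_gt0 //; apply: contra_neq v0 => b0.
by rewrite vE a0 b0 map_mx0 scaler0 addr0.
Qed.

Lemma corrected_preconditioner_spectrum_real n (A P H : 'M[R]_n) (a b : R) :
    hpd (toC A) -> hpd (toC P) -> psd (toC (P - A)) -> H^T = H ->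
    a <= 1 <= b ->
    (forall z, spectrum (H *m P) z -> a%:C <= z <= b%:C) ->
  forall z, spectrum ((H + invmx A - invmx P) *m A) z -> a%:C <= z <= b%:C.
Proof.
move=> Apd Ppd Mpsd Hs /andP[a1 b1] HPab z.
have -> : spectrum ((H + invmx A - invmx P) *m A) z =
    eigenvalue ((toC H + invmx (toC A) - invmx (toC P)) *m toC A) z.
  by rewrite /spectrum /= map_mxM map_mxB map_mxD !map_invmx.
have Mpsd' : psd (toC P - toC A) by rewrite -map_mxB.
have Hh : (toC H)^t* = toC H by rewrite ctmx_real Hs.
have a1' : a%:C <= 1 by rewrite -[1]/(1%:C) lecR.
have b1' : 1 <= b%:C by rewrite -[1]/(1%:C) lecR.
have HPab' w : eigenvalue (toC H *m toC P) w -> a%:C <= w <= b%:C.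
  by rewrite -map_mxM => /HPab.
exact: (corrected_preconditioner_spectrum Apd Ppd Mpsd' Hh a1' b1' HPab').
Qed.

End RealMatrices.

(** * Splitting the local matrices *)

Lemma spectral_partE (R : realType) m (V : 'M[R]_m) (d : 'rV[R]_m) (W : {set 'I_m}) i j :
  spectral_part V (diag_mx d) W i j = \sum_(k in W) V i k * d 0 k * V j k.
Proof.
rewrite big_enum_val /spectral_part.
rewrite (_ : mxsub _ _ _ = diag_mx (colsub enum_val d)); last first.
  by apply/matrixP => k l; rewrite !mxE (inj_eq enum_val_inj).
by rewrite mul_mx_diag mxE; apply: eq_bigr => k _; rewrite !mxE.
Qed.

(** The index sets of the positive and of the nonpositive eigenvalues partition all
    the indices, and [V L V^T] is the sum of its rank one spectral terms. *)
Lemma eigendecomposition_split (R : realType) m (B V L : 'M[R]_m) :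
  ordered_eigendecomposition B V L -> B = loc_plus V L - loc_minus V L.
Proof.
case=> _ /diag_mxP[d ->] _ ->; apply/matrixP => i j.
rewrite /loc_plus /loc_minus opprK [RHS]mxE !spectral_partE mul_mx_diag mxE.
rewrite (bigID (mem (pos_idx (diag_mx d)))) /=; congr (_ + _).
  by apply: eq_bigr => k _; rewrite !mxE.
apply: eq_big => [k|k _]; last by rewrite !mxE.
by rewrite !inE leNgt.
Qed.

Lemma assembleB (R : realType) (n N : nat) (Omega : 'I_N -> {set 'I_n})
    (X Y : forall s : 'I_N, 'M[R]_#|Omega s|) :
  assemble (fun s => X s - Y s) = assemble X - assemble Y.
Proof.
by rewrite /assemble -sumrB; apply: eq_bigr => s _; rewrite mulmxBr mulmxBl.
Qed.

(** * Spectrum of the inexact preconditioner *)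

Theorem theorem7 (R : realType) (n N : nat) (A : 'M[R]_n)
    (Omega : 'I_N -> {set 'I_n})
    (B V L : forall s : 'I_N, 'M[R]_#|Omega s|)
    (Vm : 'M[R]_(n, \rank (Aminus V L))) (Lm : 'M[R]_(\rank (Aminus V L)))
    (H2 : 'M[R]_n)
    (A_spd : spd A)
    (Omega_cover : (\bigcup_(s < N) Omega s)%SET = [set: 'I_n]%SET)
    (B_sym : forall s, (B s)^T = B s)
    (A_split : A = assemble B)
    (B_diag : forall s, ordered_eigendecomposition (B s) (V s) (L s))
    (Am_diag : reduced_diagonalization Vm Lm)
    (H2_spd : spd H2)
    (H2_spectrum : forall z : R[i], spectrum (H2 *m Aplus V L) z ->
       (lambda_min (H2 *m Aplus V L))%:C <= z
         <= (lambda_max (H2 *m Aplus V L))%:C) :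
  forall z : R[i], spectrum (H3inex H2 (Aplus V L) Vm Lm *m A) z ->
    (Num.min 1 (lambda_min (H2 *m Aplus V L)))%:C <= z
      <= (Num.max 1 (lambda_max (H2 *m Aplus V L)))%:C.
Proof.
move=> z.
have [_ /diag_mxP[d Ld] d_gt0 AmE] := Am_diag.
have PA : Aplus V L - A = Aminus V L.
  rewrite A_split (_ : assemble B = Aplus V L - Aminus V L) ?subKr //.
  rewrite -assembleB; apply: eq_bigr => s _.
  by rewrite -(eigendecomposition_split (B_diag s)).
have Apd := spd_hpd A_spd.
have Am_psd : psd (map_mx (real_complex R) (Aminus V L)).
  rewrite AmE Ld !map_mxM -ctmx_real map_diag_mx; apply/psd_congr/psd_diag => i.
  by rewrite mxE ler0c; have := d_gt0 i; rewrite Ld mxE eqxx => /ltW.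
have Am_sym : (Aminus V L)^T = Aminus V L.
  by rewrite AmE !trmx_mul trmxK Ld tr_diag_mx mulmxA.
have AplusE : map_mx (real_complex R) (Aplus V L) =
    map_mx (real_complex R) A + map_mx (real_complex R) (Aminus V L).
  by rewrite -map_mxD -PA addrC subrK.
have Ppd : hpd (map_mx (real_complex R) (Aplus V L)).
  by rewrite AplusE; apply: hpdD => //; rewrite ctmx_real Am_sym.
have Au : A \in unitmx by have := hpd_unitmx Apd; rewrite map_unitmx.
have Pu : Aplus V L \in unitmx by have := hpd_unitmx Ppd; rewrite map_unitmx.
have Lu : Lm \in unitmx.
  rewrite unitmxE Ld det_diag unitfE; apply/prodf_neq0 => i _.
  by have := d_gt0 i; rewrite Ld mxE eqxx => /lt0r_neq0.
have -> : H3inex H2 (Aplus V L) Vm Lm = H2 + invmx A - invmx (Aplus V L).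
  by rewrite /H3inex (woodbury Au Pu Lu) ?PA // addrA.
move: z; apply: (corrected_preconditioner_spectrum_real Apd Ppd).
- by rewrite PA.
- by case: H2_spd.
- by rewrite ge_min lexx le_max lexx.
move=> w /H2_spectrum/andP[lo hi].
apply/andP; split; [apply: le_trans lo | apply: le_trans hi _];
  by rewrite lecR ?ge_min ?le_max lexx orbT.
Qed.
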